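(* Let $\mathcal M\subset\mathbb R^3$ be a surface with unit normal $\nu=(\nu_1,\nu_2,\nu_3)$ and let $Q\in H^1(\mathcal M;\mathcal A)$. Suppose that $-1<M_3<2$ and $-\frac35-\frac1{10}M_3<M_2$. Then (a.e. on $\mathcal M$) $$\begin{aligned} f_e^0(\nabla_{\mathcal M}Q,\nu)={}&\frac12|\nabla_{\mathcal M}Q|^2+\frac{M_2(M_3+2)}{2(M_2+M_3+2)}\left|\mathrm{div}_{\mathcal M}Q\right|^2\\ &+\frac{(M_3^2+2M_3-1)M_2^2+(2M_3^2+5M_3+4)M_2M_3+(M_3^2+3M_3+2)M_3^2}{2(M_2+M_3+2)(2M_2+2M_3+3)}\left(\nu\cdot\mathrm{div}_{\mathcal M}Q\right)^2\\ &+\frac12\sum_{i=1}^3\left\{M_3\left(\nabla_{\mathcal M}Q_i\cdot(\nabla_{\mathcal M}Q_i)^T\right)-\frac{2M_2M_3}{M_2+M_3+2}\,\nu\cdot\left(\nu_i\nabla_{\mathcal M}Q_i\,\mathrm{div}_{\mathcal M}Q\right)\right\}\\ &-\frac{M_3^2}8\left|\sum_{i=1}^3\nu_i\left(\nabla_{\mathcal M}Q_i+\nabla_{\mathcal M}Q_i^T\right)\right|^2+\frac{M_3^2}4\,\frac{M_2+M_3}{M_2+M_3+2}\left|\sum_{i=1}^3\nu_i\nabla_{\mathcal M}Q_i^T\nu\right|^2. \end{aligned}$$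
   Context: $\mathcal M\subset\mathbb R^3$ is a compact two-dimensional $C^2$ orientable embedded surface, either closed or with smooth boundary, with unit normal field $\nu$. $\mathcal A$ is the space of real symmetric traceless $3\times3$ matrices; $A\cdot B=\mathrm{tr}(B^TA)$, $|A|^2=A\cdot A$, $(a\otimes b)_{ij}=a_ib_j$. $Q_j$ and $G_j$ denote the $j$-th columns of $Q$ and $G$. For a scalar function $f$ on $\mathcal M$, $\nabla_{\mathcal M}f=\sum_{k=1}^2(\partial_{\tau_k}f)\tau_k$ with $\{\tau_1,\tau_2\}$ an orthonormal basis of the tangent plane. For a vector field $F$ on $\mathcal M$, $\nabla_{\mathcal M}F$ is the $3\times3$ matrix whose $i$-th row is $\nabla_{\mathcal M}F^{(i)}$, $\nabla_{\mathcal M}F^T$ means $(\nabla_{\mathcal M}F)^T$, and $\mathrm{div}_{\mathcal M}F=\mathrm{tr}\,\nabla_{\mathcal M}F$. For $Q:\mathcal M\to\mathcal A$, $|\nabla_{\mathcal M}Q|^2=\sum_{j=1}^3|\nabla_{\mathcal M}Q_j|^2$ and $\mathrm{div}_{\mathcal M}Q$ is the vector with components $\mathrm{div}_{\mathcal M}Q_j$, $j=1,2,3$. For real constants $M_2,M_3$ and a triple $D=(D_1,D_2,D_3)$ of $3\times3$ matrices, $$f_e(D)=\frac12\sum_{j=1}^3\left\{|D_j|^2+M_2(\mathrm{tr}\,D_j)^2+M_3\,D_j\cdot D_j^T\right\},$$ and $$f_e^0(\nabla_{\mathcal M}Q,\nu)=\min_{G\in\mathcal A}f_e(G\otimes\nu+\nabla_{\mathcal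 M}Q),$$ where $G\otimes\nu+\nabla_{\mathcal M}Q$ denotes the triple with $j$-th entry $G_j\otimes\nu+\nabla_{\mathcal M}Q_j$. *)

(* Defs.v *)
From HB Require Import structures.
From mathcomp Require Import all_boot all_order all_algebra.
From mathcomp Require Import all_classical all_reals all_analysis.

Set Implicit Arguments.
Unset Strict Implicit.
Unset Printing Implicit Defensive.

Import Order.TTheory GRing.Theory Num.Theory.
Import numFieldNormedType.Exports.

Local Open Scope classical_set_scope.
Local Open Scope ring_scope.

Section LinearAlgebra.
Context {R : realType}.

Definition dot (u v : 'cV[R]_3) : R := \sum_(i < 3) u i 0 * v i 0.

Definition vnorm2 (u : 'cV[R]_3) : R := dot u u.

Definition mdot (A B : 'M[R]_3) : R := \tr (B^T *m A).

Definition mnorm2 (A : 'M[R]_3) : R := mdot A A.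

Definition Qtensors : set 'M[R]_3 := [set A | A^T = A /\ \tr A = 0].

(* A triple D = (D_1, D_2, D_3) of 3 x 3 matrices.  For D the gradient of a
   matrix field Q, the entry D j i k is the derivative of Q i j along e_k. *)
Definition triple := 'I_3 -> 'M[R]_3.

Definition tnorm2 (D : triple) : R := \sum_(j < 3) mnorm2 (D j).

Definition tdiv (D : triple) : 'cV[R]_3 := \col_j \tr (D j).

Definition tensor_normal (G : 'M[R]_3) (n : 'cV[R]_3) : triple :=
  fun j => col j G *m n^T.

Definition f_e (M2 M3 : R) (D : triple) : R :=
  2^-1 * \sum_(j < 3)
    (mnorm2 (D j) + M2 * (\tr (D j)) ^+ 2 + M3 * mdot (D j) (D j)^T).

Definition is_minimum (S : set R) (m : R) : Prop := S m /\ lbound S m.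

(* [is_f_e0 M2 M3 D n m] says that the minimum defining f_e^0(D, n) is attained
   and equals m. *)
Definition is_f_e0 (M2 M3 : R) (D : triple) (n : 'cV[R]_3) (m : R) : Prop :=
  is_minimum
    [set f_e M2 M3 (fun j => tensor_normal G n j + D j) | G in Qtensors] m.

End LinearAlgebra.

Section Surfaces.
Context {R : realType}.
Local Notation R3 := 'cV[R]_3.

Definition partial (i : 'I_3) (f : R3 -> R) : R3 -> R :=
  fun x => 'D_(delta_mx i 0 : R3) f x.

Definition grad (f : R3 -> R) (x : R3) : R3 := \col_i partial i f x.

(* Functions of class C^k on the open set U. *)
Fixpoint Ck (k : nat) (U : set R3) (f : R3 -> R) : Prop :=
  (forall x, U x -> {for x, continuous f}) /\
  if k is k'.+1 then
    forall i : 'I_3, (forall x, U x -> derivable f x (delta_mx i 0)) /\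
      Ck k' U (partial i f)
  else True.

Definition interior_patch (M : set R3) (p : R3) : Prop :=
  exists (V : set R3) (f : R3 -> R),
    [/\ open V, V p, Ck 2 V f,
        forall x, V x -> grad f x != 0 &
        M `&` V = [set x | f x = 0] `&` V].

(* Near a boundary point the surface is the part { h >= 0 } of { f = 0 }, the
   level sets of f and h being transversal. *)
Definition boundary_patch (M : set R3) (p : R3) : Prop :=
  exists (V : set R3) (f h : R3 -> R),
    [/\ open V, V p /\ h p = 0, Ck 2 V f /\ Ck 2 V h,
        forall x, V x -> forall a b : R,
          a *: grad f x + b *: grad h x = 0 -> a = 0 /\ b = 0 &
        M `&` V = [set x | f x = 0 /\ 0 <= h x] `&` V].

(* Compact embedded C^2 surface, with or without boundary. *)
Definition compact_surface (M : set R3) : Prop :=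
  compact M /\ forall p, M p -> interior_patch M p \/ boundary_patch M p.

(* The tangent plane at p is the common kernel of the differentials at p of
   the functions that vanish on M near p; this also gives the whole plane, and
   not a half-plane, when p is a boundary point. *)
Definition tangent_plane (M : set R3) (p : R3) : set R3 :=
  [set v | forall (V : set R3) (f : R3 -> R),
     open V -> V p -> Ck 2 V f -> (forall x, M x -> V x -> f x = 0) ->
     'D_v f p = 0].

(* Orientability of M is the existence of such a field. *)
Definition unit_normal_field (M : set R3) (nu : R3 -> R3) : Prop :=
  {within M, continuous nu} /\
  forall x, M x ->
    vnorm2 (nu x) = 1 /\ forall v, tangent_plane M x v -> dot (nu x) v = 0.

Definition orthonormal_tangent_basis (M : set R3) (x : R3)
    (tau : 'I_2 -> R3) : Prop :=
  [/\ forall k, tangent_plane M x (tau k),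
      forall k l, dot (tau k) (tau l) = (k == l)%:R &
      forall v, tangent_plane M x v -> v = \sum_(k < 2) dot v (tau k) *: tau k].

Definition tangent_basis (M : set R3) (x : R3) : 'I_2 -> R3 :=
  xget (fun=> 0) [set tau | orthonormal_tangent_basis M x tau].

(* The function on M is given through a C^1 extension to a neighbourhood of M.
   Neither the extension nor the choice of basis matters. *)
Definition tgrad (M : set R3) (f : R3 -> R) (x : R3) : R3 :=
  \sum_(k < 2) 'D_(tangent_basis M x k) f x *: tangent_basis M x k.

Definition tgradQ (M : set R3) (Q : R3 -> 'M[R]_3) (x : R3) : triple :=
  fun j => \matrix_(i, k) tgrad M (fun y => Q y i j) x k 0.

End Surfaces.

Section SurfaceMeasure.
Context {R : realType}.
Local Notation R3 := 'cV[R]_3.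
Local Open Scope ereal_scope.

(* Euclidean diameter; the term 0 makes it 0 on the empty set. *)
Definition diam (E : set R3) : \bar R :=
  maxe 0 (ereal_sup [set (Num.sqrt (vnorm2 (p.1 - p.2)))%:E
                    | p in E `*` E]).

Definition hausdorff2_cover (d : R) (A : set R3) : set (set R3)^nat :=
  [set E | (forall k, diam (E k) <= d%:E) /\ A `<=` \bigcup_k E k].

Definition hausdorff2_content (d : R) (A : set R3) : \bar R :=
  ereal_inf [set \sum_(k <oo) (pi / 4)%:E * (diam (E k) * diam (E k))
            | E in hausdorff2_cover d A].

(* Two-dimensional Hausdorff outer measure. *)
Definition hausdorff2 (A : set R3) : \bar R :=
  ereal_sup [set hausdorff2_content d A | d in [set d : R | (0 < d)%R]].

(* Surface measure of M, extended by 0 outside of M. *)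
Definition surface_measure (M : set R3) (A : set R3) : \bar R :=
  hausdorff2 (A `&` M).

Lemma diam_ge0 E : 0 <= diam E.
Proof. by rewrite /diam le_max lexx. Qed.

Lemma diam0 : diam set0 = 0.
Proof. by rewrite /diam set0X image_set0 ereal_sup0 max_l// leNye. Qed.

Let gauge (d : R) (E : set (g_sigma_algebraType [set: set R3])) : \bar R :=
  if diam E <= d%:E then (pi / 4)%:E * (diam E * diam E) else +oo.

Let pi4_ge0 : (0 <= pi / 4 :> R)%R.
Proof. by rewrite divr_ge0// pi_ge0. Qed.

Let term_ge0 E : 0 <= (pi / 4)%:E * (diam E * diam E).
Proof. by rewrite mule_ge0 ?lee_fin ?pi4_ge0// mule_ge0// diam_ge0. Qed.

Let gauge_ge0 d E : 0 <= gauge d E.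
Proof. by rewrite /gauge; case: ifP => // _; exact: term_ge0. Qed.

Let gauge0 d : (0 < d)%R -> gauge d set0 = 0.
Proof. by move=> d0; rewrite /gauge diam0 lee_fin ltW// !mule0. Qed.

Let contentE d A : hausdorff2_content d A = mu_ext (gauge d) A.
Proof.
apply/eqP; rewrite eq_le; apply/andP; split; last first.
  apply: le_ereal_inf_tmp => _ [E [dE AE] <-].
  apply: ereal_inf_lbound; exists E.
    by split => // i; exact: sub_sigma_algebra.
  by apply: eq_eseriesr => k _; rewrite /gauge dE.
apply: le_ereal_inf_tmp => _ [E [mE AE] <-].
have [dE|] := pselect (forall k, diam (E k) <= d%:E).
  apply: ereal_inf_lbound; exists E => //.
  by apply: eq_eseriesr => k _; rewrite /gauge dE.
move=> /existsNP[k /negP dEk].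
have gaugeoo : gauge d (E k) = +oo by rewrite /gauge (negbTE dEk).
rewrite (eseries_pinfty _ _ gaugeoo) ?leey// => n _.
by rewrite gt_eqF// (lt_le_trans _ (gauge_ge0 _ _)).
Qed.

Lemma hausdorff2_content_ge0 d A : 0 <= hausdorff2_content d A.
Proof. by rewrite contentE; exact/mu_ext_ge0/gauge_ge0. Qed.

Lemma hausdorff2_content_le d :
  {homo hausdorff2_content d : A B / A `<=` B >-> A <= B}.
Proof. by move=> A B AB; rewrite !contentE; exact: le_mu_ext. Qed.

Lemma hausdorff2_content_sigma_subadditive d :
  sigma_subadditive (hausdorff2_content d).
Proof.
move=> F; rewrite contentE; under eq_eseriesr do rewrite contentE.
exact/mu_ext_sigma_subadditive/gauge_ge0.
Qed.

Lemma hausdorff2_ge0 A : 0 <= hausdorff2 A.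
Proof.
apply: le_trans (hausdorff2_content_ge0 1 A) _.
by apply: ereal_sup_ubound; exists 1%R => //=.
Qed.

Variable M : set R3.

Lemma surface_measure0 : surface_measure M set0 = 0.
Proof.
rewrite /surface_measure set0I; apply/eqP; rewrite eq_le hausdorff2_ge0 andbT.
apply: ge_ereal_sup => _ [d d0 <-].
by rewrite contentE mu_ext0//; exact: gauge0.
Qed.

Lemma surface_measure_ge0 A : 0 <= surface_measure M A.
Proof. exact: hausdorff2_ge0. Qed.

Lemma le_surface_measure :
  {homo surface_measure M : A B / A `<=` B >-> A <= B}.
Proof.
move=> A B AB; apply: ge_ereal_sup => _ [d d0 <-].
apply: (@le_trans _ _ (hausdorff2_content d (B `&` M))).
  by apply: hausdorff2_content_le; exact: setSI.
by apply: ereal_sup_ubound; exists d.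
Qed.

Lemma surface_measure_sigma_subadditive :
  sigma_subadditive (surface_measure M).
Proof.
move=> F; apply: ge_ereal_sup => _ [d d0 <-].
rewrite setI_bigcupl.
apply: le_trans (hausdorff2_content_sigma_subadditive _ _) _.
apply: lee_nneseries => [k _ _|k _]; first exact: hausdorff2_content_ge0.
by apply: ereal_sup_ubound; exists d.
Qed.

HB.instance Definition _ := isOuterMeasure.Build R R3 (surface_measure M)
  surface_measure0 surface_measure_ge0 le_surface_measure
  surface_measure_sigma_subadditive.

End SurfaceMeasure.

Section Area.
Context {R : realType}.
Local Notation R3 := 'cV[R]_3.

Definition outer_area (M : set R3) : {outer_measure set R3 -> \bar R} :=
  surface_measure M.

(* Same set function as surface_measure M, as a measure on its Caratheodory
   sigma-algebra. *)
Definition area (M : set R3) :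
    {measure set (caratheodory_type (outer_area M)) -> \bar R} :=
  outer_area M : set (caratheodory_type (outer_area M)) -> \bar R.

End Area.

Section Sobolev.
Context {R : realType}.
Local Notation R3 := 'cV[R]_3.
Local Open Scope ereal_scope.

Definition L2_matrix_field (M : set R3) (Q : R3 -> 'M[R]_3) : Prop :=
  (forall i j, measurable_fun [set: caratheodory_type (outer_area M)]
     (fun x : caratheodory_type (outer_area M) => Q x i j)) /\
  \int[area M]_(x in M) (mnorm2 (Q x))%:E < +oo.

(* C^1 maps from a neighbourhood of M to the symmetric traceless matrices. *)
Definition C1_Qtensor_field (M : set R3) (F : R3 -> 'M[R]_3) : Prop :=
  (forall x, Qtensors (F x)) /\
  exists W : set R3, [/\ open W, M `<=` W &
    forall i j, Ck 1 W (fun x => F x i j)].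

(* Q belongs to H^1(M; Qtensors) and D is its tangential gradient.  H^1 is the
   completion of C^1(M; Qtensors) for the norm of H^1, realised inside L^2: the
   pair (Q, D) is an L^2 limit of pairs (F, tgradQ M F) with F of class C^1.
   Like the classical gradient, D has its values in the tangent planes. *)
Definition H1_with_gradient (M : set R3) (Q : R3 -> 'M[R]_3)
    (D : R3 -> triple) : Prop :=
  [/\ forall x, M x -> Qtensors (Q x),
      L2_matrix_field M Q,
      forall j, L2_matrix_field M (fun x => D x j),
      {ae area M, forall x, M x ->
         forall j i, tangent_plane M x (row i (D x j))^T} &
      exists F : nat -> R3 -> 'M[R]_3,
        [/\ forall n, C1_Qtensor_field M (F n),
            \int[area M]_(x in M) (mnorm2 (F n x - Q x))%:E
              @[n --> \oo] --> 0 &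
            \int[area M]_(x in M)
              (tnorm2 (fun j => tgradQ M (F n) x j - D x j))%:E
              @[n --> \oo] --> 0]].

End Sobolev.

(* Main.v *)
(* Since D_j nu = 0 and D_j i k is symmetric in i and j, the energy splits as
   f_e (G (x) nu + D) = f_e D + (|G|^2 + (M2 + M3) |G nu|^2) / 2
                        + M2 (G nu) . div Q + M3 G . N,  N = sum_l nu_l D_l.
   On symmetric traceless matrices |G|^2 >= 3/2 |G nu|^2, and the hypotheses
   give M2 + M3 > -3/2, so the quadratic part is nonnegative there and any
   solution of the Euler-Lagrange equation is a minimizer; solving the equation
   explicitly yields the value.  Symmetry of D in i and j holds for C^1 fields
   and passes to the L^2 limit almost everywhere. *)
Require Import Defs.
From mathcomp Require Import all_boot all_order all_algebra.
From mathcomp Require Import all_classical all_reals all_analysis.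
From mathcomp Require Import measurable_realfun ring lra.
Import Order.TTheory GRing.Theory Num.Theory.
Import numFieldNormedType.Exports.
Local Open Scope classical_set_scope.
Local Open Scope ring_scope.

(** * Inner products of vectors and matrices, and a sharp norm bound *)

Section Products.
Context {R : realType}.
Implicit Types (u v : 'cV[R]_3) (A B C : 'M[R]_3) (a : R).

Lemma dotE u v : dot u v = \tr (u^T *m v).
Proof. by rewrite /mxtrace big_ord1 mxE; apply: eq_bigr => i _; rewrite mxE. Qed.

Lemma dotC u v : dot u v = dot v u.
Proof. by apply: eq_bigr => i _; rewrite mulrC. Qed.

Lemma dotDl u v w : dot (u + v) w = dot u w + dot v w.
Proof. by rewrite !dotE linearD /= mulmxDl linearD. Qed.

Lemma dotZl a u v : dot (a *: u) v = a * dot u v.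
Proof. by rewrite !dotE linearZ /= -scalemxAl linearZ. Qed.

Lemma dotNl u v : dot (- u) v = - dot u v.
Proof. by rewrite -scaleN1r dotZl mulN1r. Qed.

Lemma dotDr u v w : dot w (u + v) = dot w u + dot w v.
Proof. by rewrite dotC dotDl !(dotC w). Qed.

Lemma dotZr a u v : dot v (a *: u) = a * dot v u.
Proof. by rewrite dotC dotZl (dotC v). Qed.

Lemma dotNr u v : dot v (- u) = - dot v u.
Proof. by rewrite dotC dotNl (dotC v). Qed.

Lemma dot0l v : dot 0 v = 0.
Proof. by rewrite -(scale0r v) dotZl mul0r. Qed.

Lemma dot_mulmx A u v : dot u (A *m v) = dot (A^T *m u) v.
Proof. by rewrite !dotE trmx_mul trmxK mulmxA. Qed.

Lemma vnorm2_ge0 u : 0 <= vnorm2 u.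
Proof. by apply: sumr_ge0 => i _; rewrite -expr2 sqr_ge0. Qed.

Lemma mdotC A B : mdot A B = mdot B A.
Proof. by rewrite /mdot -mxtrace_tr trmx_mul trmxK. Qed.

Lemma mdotDl A B C : mdot (A + B) C = mdot A C + mdot B C.
Proof. by rewrite /mdot mulmxDr linearD. Qed.

Lemma mdotZl a A B : mdot (a *: A) B = a * mdot A B.
Proof. by rewrite /mdot -scalemxAr linearZ. Qed.

Lemma mdotNl A B : mdot (- A) B = - mdot A B.
Proof. by rewrite -scaleN1r mdotZl mulN1r. Qed.

Lemma mdotDr A B C : mdot C (A + B) = mdot C A + mdot C B.
Proof. by rewrite mdotC mdotDl !(mdotC C). Qed.

Lemma mdotNr A B : mdot B (- A) = - mdot B A.
Proof. by rewrite mdotC mdotNl (mdotC B). Qed.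

Lemma mdot_tr A B : mdot A^T B = mdot A B^T.
Proof. by rewrite /mdot trmxK -mxtrace_tr trmx_mul !trmxK mxtrace_mulC. Qed.

Lemma mdot_outerl u v A : mdot (u *m v^T) A = dot u (A *m v).
Proof.
by rewrite mdotC /mdot dotE trmx_mul trmxK -mulmxA mxtrace_mulC mulmxA.
Qed.

Lemma mdot_scalarl a A : mdot a%:M A = a * \tr A.
Proof. by rewrite /mdot mul_mx_scalar linearZ /= mxtrace_tr. Qed.

Lemma mdotE A B : mdot A B = \sum_i \sum_j A i j * B i j.
Proof.
rewrite /mdot exchange_big /=; apply: eq_bigr => j _.
by rewrite mxE; apply: eq_bigr => i _; rewrite mxE mulrC.
Qed.

Lemma mnorm2_ge0 A : 0 <= mnorm2 A.
Proof.
rewrite /mnorm2 mdotE; apply: sumr_ge0 => i _; apply: sumr_ge0 => j _.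
by rewrite -expr2 sqr_ge0.
Qed.

Lemma trace_outer u v : \tr (u *m v^T) = dot u v.
Proof. by rewrite mxtrace_mulC dotC dotE. Qed.

Lemma outer_mulmx u v w : u *m v^T *m w = dot v w *: u.
Proof.
rewrite -mulmxA; have -> : v^T *m w = (dot v w)%:M.
  by apply/matrixP => i j; rewrite !ord1 dotE /mxtrace big_ord1 [RHS]mxE eqxx mulr1n.
by rewrite mul_mx_scalar.
Qed.

Lemma mdot_cols A B : \sum_j dot (col j A) (col j B) = mdot A B.
Proof.
by rewrite mdotE exchange_big; apply: eq_bigr => j _; apply: eq_bigr => i _;
  rewrite !mxE.
Qed.

(** [H - P] is orthogonal to [P], so |H|^2 >= |P|^2 = 2 |u|^2 - q^2 / 2, and q^2 <= |u|^2 because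
    [n] is a unit vector. *)
Lemma vnorm2_mul_le (n : 'cV[R]_3) (H : 'M[R]_3) (q := dot n (H *m n)) :
  vnorm2 n = 1 -> H^T = H -> \tr H = 0 ->
  3 / 2 * vnorm2 (H *m n) <= mnorm2 H.
Proof.
rewrite /vnorm2 => n1 Hsym Htr.
set u := H *m n in q *.
(* The traceless symmetric matrix of least norm that maps n to u. *)
pose P : 'M[R]_3 := u *m n^T + n *m u^T - (q / 2) *: (n *m n^T) - (q / 2)%:M.
have un : dot u n = q by rewrite dotC.
(* Against a symmetric traceless [A], [P] only sees [A *m n]; hence [H] and [P] have the same
   product with [P]. *)
have mP A : A^T = A -> \tr A = 0 ->
    mdot P A = 2 * dot u (A *m n) - q / 2 * dot n (A *m n).
  move=> Asym Atr; rewrite !(mdotDl, mdotNl, mdotZl) !mdot_outerl mdot_scalarl.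
  by rewrite Atr (dot_mulmx _ n u) Asym (dotC _ u); ring.
have Psym : P^T = P.
  rewrite /P !(linearB, linearD, linearZ) /= !trmx_mul !trmxK tr_scalar_mx.
  by rewrite (addrC (u *m n^T)).
have Ptr : \tr P = 0.
  rewrite /P !(mxtraceD, mxtraceZ, raddfN) /= ?mxtraceZ !trace_outer n1 mxtrace_scalar.
  by rewrite un (dotC n u) un; field.
have Pn : P *m n = u.
  rewrite /P !(mulmxDl, mulNmx) mul_scalar_mx -scalemxAl !outer_mulmx n1 un.
  by apply/matrixP => i j; rewrite !(mxE, addrA); field.
move: P mP Psym Ptr Pn => P mP Psym Ptr Pn.
have H1 : mnorm2 (H - P) = mnorm2 H - 2 * vnorm2 u + q ^+ 2 / 2.
  rewrite /mnorm2 !(mdotDl, mdotDr, mdotNl, mdotNr) (mdotC H P) !mP// Pn -/u.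
  by rewrite -/q /vnorm2; field.
have H2 : vnorm2 (u - q *: n) = vnorm2 u - q ^+ 2.
  rewrite /vnorm2 !(dotDl, dotDr, dotNl, dotNr, dotZl, dotZr) n1 un (dotC n u) un.
  by ring.
have := mnorm2_ge0 (H - P); have := vnorm2_ge0 (u - q *: n).
by rewrite H1 H2 /vnorm2 -/u; lra.
Qed.

End Products.

(** * Pointwise minimisation over the normal part of the gradient *)

Section ElasticEnergy.
Context {R : realType}.
Variables (M2 M3 : R) (D : @triple R) (n : 'cV[R]_3).
Hypothesis n1 : vnorm2 n = 1.
Hypothesis Dn : forall j, D j *m n = 0.
Hypothesis Dsym : forall j i k, D j i k = D i j k.

Local Notation N := (\sum_(l < 3) n l 0 *: D l).
Local Notation d := (tdiv D).

(** Exchanging the first two indices turns D_j^T n into row j of [N]; this is how [N] enters the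
    [M3] term. *)
Lemma normal_contraction_tr j : (D j)^T *m n = col j N^T.
Proof.
apply/matrixP => i k; rewrite !ord1 !mxE summxE; apply: eq_bigr => l _.
by rewrite !mxE Dsym mulrC.
Qed.

Lemma normal_contraction_mul : N *m n = 0.
Proof.
rewrite mulmx_suml big1// => l _.
by rewrite -scalemxAl Dn scaler0.
Qed.

Lemma trace_normal_contraction : \tr N = dot n d.
Proof.
rewrite raddf_sum; apply: eq_bigr => l _.
by rewrite /= mxtraceZ !mxE.
Qed.

(** D_j n = 0 removes the cross term from the squared norms, and (G_j n^T) . (n G_j^T) = (G_j . n)^2
    puts [M3] beside [M2] in front of |G n|^2. *)
Lemma f_e_tensor_normal (G : 'M[R]_3) : G^T = G ->
  f_e M2 M3 (fun j => tensor_normal G n j + D j) =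
  f_e M2 M3 D + 2^-1 * (mnorm2 G + (M2 + M3) * vnorm2 (G *m n))
  + M2 * dot (G *m n) d + M3 * mdot G N.
Proof.
move=> Gsym.
have Gn j : dot (col j G) n = (G *m n) j 0.
  by rewrite -{2}Gsym mxE; apply: eq_bigr => i _; rewrite !mxE.
have E j : mnorm2 (tensor_normal G n j + D j)
    + M2 * (\tr (tensor_normal G n j + D j)) ^+ 2
    + M3 * mdot (tensor_normal G n j + D j) (tensor_normal G n j + D j)^T =
  (mnorm2 (D j) + M2 * (\tr (D j)) ^+ 2 + M3 * mdot (D j) (D j)^T)
  + (dot (col j G) (col j G) + (M2 + M3) * ((G *m n) j 0 * (G *m n) j 0)
  + 2 * M2 * ((G *m n) j 0 * d j 0) + 2 * M3 * dot (col j G) (col j N^T)).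
  rewrite /tensor_normal /mnorm2 !(linearD (@mxtrace _ _), linearD (@trmx _ _ _)) /=.
  rewrite trace_outer Gn trmx_mul trmxK !(mdotDl, mdotDr).
  rewrite (mdotC (D j) (_ *m n^T)) (mdotC (D j) (n *m _)).
  rewrite !mdot_outerl (dot_mulmx (D j) n) !outer_mulmx Dn normal_contraction_tr.
  rewrite !dotZr Gn (dotC (col j N^T)).
  rewrite [dot n n]n1 [d j 0]mxE (dotC _ 0) dot0l.
  by ring.
rewrite /f_e (eq_bigr _ (fun j _ => E j)) !big_split /= -!mulr_sumr.
rewrite !mdot_cols -mdot_tr Gsym -/(mnorm2 G).
rewrite -/(dot (G *m n) (G *m n)) -/(vnorm2 _) -/(dot (G *m n) d).
by field.
Qed.

Hypothesis M23_gt0 : 0 < 2 * (M2 + M3) + 3.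

Let c := M2 + M3.
Let dn := dot n d.
Let w := N^T *m n.
(** The number [q] is n . u. In the Euler-Lagrange equation below, the nn-component gives q + n . a
    + lam = 0 and the trace gives n . a + M3 dn + 3 lam = 0; with n . a = M2 dn + c q these fix [q]
    and [lam]. Applied to [n] and projected orthogonally to [n], the equation gives the rest of
    [u]. *)
Let q := (M3 - 2 * M2) * dn / (2 * c + 3).
Let lam := - (1 + c) * q - M2 * dn.
Let u := q *: n - (c + 2)^-1 *: (M2 *: (d - dn *: n) + M3 *: w).
Let a := M2 *: d + c *: u.

(* [u] is the value at [n], and [lam] the Lagrange multiplier of the trace
   constraint, found by solving the Euler-Lagrange equation
   G + sym (a n^T) + M3 sym N + lam I = 0. *)
Definition optimal_normal_part : 'M[R]_3 :=
  - (M3 / 2) *: (N + N^T) - 2^-1 *: (a *m n^T + n *m a^T) - lam%:M.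

Local Notation G0 := optimal_normal_part.

Let c3 : 2 * c + 3 != 0. Proof. by rewrite gt_eqF. Qed.
Let c2 : c + 2 != 0. Proof. by rewrite gt_eqF// /c; move: M23_gt0; lra. Qed.

Let nw : dot n w = 0.
Proof. by rewrite dotC -dot_mulmx normal_contraction_mul dotC dot0l. Qed.

Let nu_ : dot n u = q.
Proof.
rewrite /u !(dotDr, dotNr, dotZr) nw -/dn [dot n n]n1.
by ring.
Qed.

Let na : dot n a = M2 * dn + c * q.
Proof. by rewrite /a dotDr !dotZr nu_. Qed.

Lemma optimal_normal_part_sym : G0^T = G0.
Proof.
rewrite /optimal_normal_part; generalize a lam N => v l A.
apply/matrixP => i k; rewrite !mxE !big_ord1 !mxE eq_sym; ring.
Qed.

Lemma optimal_normal_part_tr : \tr G0 = 0.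
Proof.
have E v l (A : 'M[R]_3) :
    \tr (- (M3 / 2) *: (A + A^T) - 2^-1 *: (v *m n^T + n *m v^T) - l%:M) =
    - M3 * \tr A - dot n v - 3 * l.
  rewrite !(mxtraceD, mxtraceZ, raddfN) /= !mxtraceZ !mxtraceD.
  by rewrite mxtrace_tr mxtrace_scalar !trace_outer (dotC v); field.
rewrite /optimal_normal_part E trace_normal_contraction na -/dn /lam /q.
by field.
Qed.

(** Consistency check: [u] already occurs in [G0] through [a]. *)
Lemma optimal_normal_part_mul : G0 *m n = u.
Proof.
have E v l (A : 'M[R]_3) : A *m n = 0 ->
    (- (M3 / 2) *: (A + A^T) - 2^-1 *: (v *m n^T + n *m v^T) - l%:M) *m n =
    - (M3 / 2) *: (A^T *m n) - 2^-1 *: (v + dot n v *: n) - l *: n.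
  move=> An; rewrite !(mulmxDl, mulNmx) -!scalemxAl !mulmxDl.
  by rewrite mul_scalar_mx An add0r !outer_mulmx [dot n n]n1 scale1r (dotC v).
rewrite /optimal_normal_part E ?normal_contraction_mul// na -/w /a.
have -> : lam = - (1 + c) * q - M2 * dn by [].
have -> : u = q *: n - (c + 2)^-1 *: (M2 *: (d - dn *: n) + M3 *: w) by [].
generalize d w => d' w'.
apply/matrixP => i j; rewrite !mxE.
by field.
Qed.

(** The first variation of the energy along [H]: the [N] and [a] parts of [G0] cancel the other
    terms, and [lam%:M] pairs with [H] to a multiple of its trace. *)
Lemma optimal_normal_part_stationary (H : 'M[R]_3) : H^T = H -> \tr H = 0 ->
  mdot G0 H + c * dot u (H *m n) + M2 * dot (H *m n) d + M3 * mdot H N = 0.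
Proof.
move=> Hsym Htr.
rewrite /optimal_normal_part !(mdotDl, mdotNl, mdotZl) !mdot_outerl mdot_scalarl.
rewrite mdot_tr Hsym Htr (dot_mulmx _ n) Hsym (dotC _ a) /a dotDl !dotZl.
by rewrite (mdotC H) (dotC _ d); field.
Qed.

(** For G = G0 + H stationarity removes the terms linear in [H]; what remains is (|H|^2 + c |H n|^2)
    / 2 >= (2 c + 3) |H n|^2 / 4 >= 0. *)
Lemma f_e_optimal_normal_part_le (G : 'M[R]_3) : G^T = G -> \tr G = 0 ->
  f_e M2 M3 (fun j => tensor_normal G0 n j + D j) <=
  f_e M2 M3 (fun j => tensor_normal G n j + D j).
Proof.
move: optimal_normal_part_sym optimal_normal_part_tr optimal_normal_part_mul.
move: optimal_normal_part_stationary; generalize G0 u => P v st Psym Ptr Pn.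
move=> Gsym Gtr; pose H := G - P.
have Hsym : H^T = H by rewrite /H linearB /= Gsym Psym.
have Htr : \tr H = 0 by rewrite /H linearB /= Gtr Ptr subr0.
have -> : G = P + H by rewrite /H addrC subrK.
clearbody H; have {}st := st _ Hsym Htr.
have := vnorm2_mul_le _ _ n1 Hsym Htr; have := vnorm2_ge0 (H *m n).
rewrite !f_e_tensor_normal ?linearD /= ?Hsym ?Psym// mulmxDl Pn.
rewrite /mnorm2 /vnorm2 !(mdotDl, mdotDr, dotDl, dotDr).
rewrite (mdotC H P) (dotC (H *m n) v).
have := M23_gt0; set h2 := dot (H *m n) (H *m n); set k2 := mdot H H.
move: st; rewrite /c => st c_gt0 h2_ge0 hk.
have := mulr_ge0 (ltW c_gt0) h2_ge0.
lra.
Qed.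

(** Stationarity along [G0] itself: the quadratic part is minus half of the linear part. *)
Lemma f_e_optimal_normal_part :
  f_e M2 M3 (fun j => tensor_normal G0 n j + D j) =
  f_e M2 M3 D + 2^-1 * (M2 * dot u d + M3 * mdot G0 N).
Proof.
have := optimal_normal_part_stationary _
  optimal_normal_part_sym optimal_normal_part_tr.
rewrite f_e_tensor_normal; last exact: optimal_normal_part_sym.
rewrite optimal_normal_part_mul /mnorm2 /vnorm2 /c => st; lra.
Qed.

Lemma f_e_optimal_normal_partE :
  f_e M2 M3 (fun j => tensor_normal G0 n j + D j) =
  1 / 2 * tnorm2 D
  + M2 * (M3 + 2) / (2 * (M2 + M3 + 2)) * vnorm2 d
  + ((M3 ^+ 2 + 2 * M3 - 1) * M2 ^+ 2
     + (2 * M3 ^+ 2 + 5 * M3 + 4) * M2 * M3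
     + (M3 ^+ 2 + 3 * M3 + 2) * M3 ^+ 2)
    / (2 * (M2 + M3 + 2) * (2 * M2 + 2 * M3 + 3))
    * (dot n d) ^+ 2
  + 1 / 2 * \sum_(i < 3)
      (M3 * mdot (D i) (D i)^T
       - 2 * M2 * M3 / (M2 + M3 + 2)
         * dot n (n i 0 *: (D i *m d)))
  - M3 ^+ 2 / 8
    * mnorm2 (\sum_(i < 3) n i 0 *: (D i + (D i)^T))
  + M3 ^+ 2 / 4 * ((M2 + M3) / (M2 + M3 + 2))
    * vnorm2 (\sum_(i < 3) n i 0 *: ((D i)^T *m n)).
Proof.
rewrite f_e_optimal_normal_part.
have trN : N^T = \sum_(l < 3) n l 0 *: (D l)^T.
  by rewrite raddf_sum; apply: eq_bigr => l _; rewrite /= linearZ.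
have -> : \sum_(i < 3) n i 0 *: (D i + (D i)^T) = N + N^T.
  by rewrite trN -big_split; apply: eq_bigr => l _; rewrite scalerDr.
have -> : \sum_(i < 3) n i 0 *: ((D i)^T *m n) = w.
  by rewrite /w trN mulmx_suml; apply: eq_bigr => l _; rewrite -scalemxAl.
(* The sum is n . (N d), and the transpose moves [N] onto [n]. *)
have sumd : \sum_(i < 3) dot n (n i 0 *: (D i *m d)) = dot w d.
  rewrite /w -dot_mulmx mulmx_suml dotE mulmx_sumr raddf_sum.
  by apply: eq_bigr => i _; rewrite /= -scalemxAl dotE.
pose trsum := \sum_(i < 3) mdot (D i) (D i)^T.
rewrite sumrB -!mulr_sumr sumd -/trsum.
have fD : f_e M2 M3 D = 2^-1 * (tnorm2 D + M2 * vnorm2 d + M3 * trsum).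
  rewrite /f_e !big_split /= -!mulr_sumr; congr (_ * (_ + _ * _ + _)).
  by apply: eq_bigr => j _; rewrite !mxE expr2.
have ud : dot u d = q * dn
    - (c + 2)^-1 * (M2 * (vnorm2 d - dn * dn) + M3 * dot w d).
  by rewrite /u !(dotDl, dotNl, dotZl).
have wa : dot w a = M2 * dot w d
    - c * (c + 2)^-1 * (M2 * dot w d + M3 * vnorm2 w).
  rewrite /a /u /vnorm2 !(dotDr, dotNr, dotZr) (dotC w n) nw; ring.
have G0N : mdot G0 N = - (M3 / 2) * (mnorm2 N + mdot N^T N)
    - 2^-1 * dot w a - lam * dn.
  rewrite /optimal_normal_part; move: normal_contraction_mul.
  move: trace_normal_contraction; rewrite -/dn /w; generalize a lam N => v l A.
  move=> trA An; rewrite /mnorm2 !(mdotDl, mdotNl, mdotZl) !mdot_outerl.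
  by rewrite mdot_scalarl trA An (dotC v) dot0l add0r dot_mulmx.
have NN : mnorm2 (N + N^T) = 2 * (mnorm2 N + mdot N^T N).
  rewrite /mnorm2; generalize N => A; rewrite !(mdotDl, mdotDr).
  by rewrite (mdot_tr A A^T) trmxK (mdotC A A^T); ring.
rewrite fD ud G0N wa NN /lam /q -/dn /c.
move: c2 c3; rewrite /c.
(* What is left is a rational identity in [M2], [M3] and seven scalars, with c + 2 and 2 c + 3
   nonzero. *)
generalize (vnorm2 d) (vnorm2 w) (dot w d) dn (mnorm2 N + mdot N^T N) (tnorm2 D).
generalize trsum.
move=> x0 x1 x2 x3 x4 x5 x6 h2 h3; field.
by rewrite h2 -mulrDr h3.
Qed.

Lemma optimal_normal_part_is_f_e0 :
  is_f_e0 M2 M3 D n (f_e M2 M3 (fun j => tensor_normal G0 n j + D j)).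
Proof.
split.
  exists G0 => //; split.
    exact: optimal_normal_part_sym.
  exact: optimal_normal_part_tr.
by move=> _ [G [Gsym Gtr] <-]; exact: f_e_optimal_normal_part_le.
Qed.

End ElasticEnergy.

(* No measurability is assumed: the integral of a nonnegative function is a
   supremum over the simple functions below it. *)
Lemma ge0_le_lower_integral (d : measure_display) (T : measurableType d)
    (R : realType) (mu : {measure set T -> \bar R}) (A : set T)
    (f g : T -> \bar R) :
  (forall x, A x -> (0 <= f x)%E) -> (forall x, A x -> (f x <= g x)%E) ->
  (\int[mu]_(x in A) f x <= \int[mu]_(x in A) g x)%E.
Proof.
move=> f0 fg.
have g0 x : A x -> (0 <= g x)%E by move=> Ax; exact: le_trans (f0 x Ax) (fg x Ax).
rewrite !ge0_integralE//; apply: le_ereal_sup => _ [h hf <-]; exists h => // x.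
by apply: le_trans (hf x) _; exact: lee_restrict.
Qed.

(** The dominated function does not depend on [n], so its integral lies below a sequence tending to
    0 and vanishes. *)
Lemma ae_eq_of_sqr_dominated (d : measure_display) (T : measurableType d)
    (R : realType) (mu : {measure set T -> \bar R}) (A : set T)
    (f1 f2 : T -> R) (g : nat -> T -> \bar R) :
  measurable A -> measurable_fun setT f1 -> measurable_fun setT f2 ->
  (forall n x, A x -> (((f1 x - f2 x) ^+ 2 / 4)%:E <= g n x)%E) ->
  (\int[mu]_(x in A) g n x)%E @[n --> \oo] --> 0%E ->
  {ae mu, forall x, A x -> f1 x = f2 x}.
Proof.
move=> mA mf1 mf2 fg g_cvg.
pose h x : \bar R := ((f1 x - f2 x) ^+ 2 / 4)%:E.
have mh : measurable_fun A h.
  apply: measurable_funTS; apply/measurable_EFinP; apply: measurable_funM => //.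
  by apply: measurable_funX; exact: measurable_funB.
have h0 x : (0 <= h x)%E by rewrite lee_fin divr_ge0// sqr_ge0.
have inth : (\int[mu]_(x in A) `|h x| = 0)%E.
  under eq_integral do rewrite gee0_abs//.
  apply/eqP; rewrite eq_le integral_ge0// andbT.
  apply: (cvge_ge _ g_cvg).
  by near=> n; apply: ge0_le_lower_integral => // x Ax; exact: fg.
apply: filterS ((ae_eq_integral_abs mu mA mh).1 inth) => x /= hx /hx[].
by move/eqP; rewrite mulf_eq0 invr_eq0 pnatr_eq0 orbF sqrf_eq0 subr_eq0 => /eqP.
Unshelve. all: by end_near. Qed.

(** * Symmetry of the weak gradient in its first two indices *)

Section GradientSymmetry.
Context {R : realType}.
Local Notation R3 := 'cV[R]_3.

(** The outer measure only sees [M], so the part of any set outside [M] is null and the Caratheodory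
    criterion holds. *)
Lemma measurable_surface (M : set R3) :
  measurable (M : set (caratheodory_type (outer_area M))).
Proof.
apply: le_caratheodory_measurable => X.
rewrite /outer_area /= /surface_measure.
rewrite -!setIA setIid setICl setI0 -[X in (_ + X)%E]/(hausdorff2 set0).
have := @surface_measure0 R setT; rewrite /surface_measure set0I => ->.
by rewrite adde0.
Qed.

Lemma tnorm2_ge_entry (D : @triple R) j i k : D j i k ^+ 2 <= tnorm2 D.
Proof.
rewrite /tnorm2 (bigD1 j)//= /mnorm2 mdotE (bigD1 i)//= (bigD1 k)//= -expr2.
rewrite -!addrA lerDl; do !apply: addr_ge0.
- by apply: sumr_ge0 => *; rewrite -expr2 sqr_ge0.
- by do 2!apply: sumr_ge0 => *; rewrite -expr2 sqr_ge0.
apply: sumr_ge0 => *; rewrite /mnorm2 mdotE.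
by do 2!apply: sumr_ge0 => *; rewrite -expr2 sqr_ge0.
Qed.

Lemma tgradQ_sym (M : set R3) (F : R3 -> 'M[R]_3) (x : R3) j i k :
  (forall y, Qtensors (F y)) -> tgradQ M F x j i k = tgradQ M F x i j k.
Proof.
move=> FQ; rewrite !mxE; congr (tgrad M _ x k 0); apply/funext => y.
by have [/matrixP/(_ i j)] := FQ y; rewrite mxE.
Qed.

Lemma H1_gradient_sym (M : set R3) (Q : R3 -> 'M[R]_3) (D : R3 -> triple) :
  H1_with_gradient M Q D ->
  {ae area M, forall x, M x -> forall j i k, D x j i k = D x i j k}.
Proof.
move=> [_ _ D2 _ [F [FQ _ FD]]].
have one j i k : {ae area M, forall x, M x -> D x j i k = D x i j k}.
  have [mDji _] := D2 j; have [mDij _] := D2 i.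
  apply: (ae_eq_of_sqr_dominated _ _ _ _ _ _ _ _
    (measurable_surface M) (mDji i k) (mDij j k) _ FD) => n x _.
  rewrite lee_fin; set E := fun l => _.
  have h1 := tnorm2_ge_entry E j i k; have h2 := tnorm2_ge_entry E i j k.
  (* The gradient of [F n] is symmetric, so the asymmetry of [D] is that of the error [E]. The
     factor 4 comes from (a - b)^2 <= 2 a^2 + 2 b^2. *)
  have Eji : D x j i k - D x i j k = E i j k - E j i k.
    have [FQn _] := FQ n.
    rewrite /E !mxE; have := tgradQ_sym M (F n) x j i k FQn; rewrite !mxE => ->.
    by ring.
  rewrite Eji ler_pdivrMr//; have := sqr_ge0 (E i j k + E j i k).
  by rewrite sqrrD sqrrB; lra.
(* There are finitely many index triples, so one null set serves them all. *)
have {}one : {ae area M, forall x (p : 'I_3 * 'I_3 * 'I_3), M x ->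
    D x p.1.1 p.1.2 p.2 = D x p.1.2 p.1.1 p.2}.
  by apply: filter_forall => -[[j i] k]; exact: one.
have aeF := ae_filter_ringOfSetsType (area M).
by apply: (@filterS _ _ aeF _ _ _ one) => x xp Mx j i k; exact: (xp (j, i, k)).
Qed.

End GradientSymmetry.

Theorem lemma4p2 (R : realType) (M : set 'cV[R]_3) (nu : 'cV[R]_3 -> 'cV[R]_3)
    (Q : 'cV[R]_3 -> 'M[R]_3) (D : 'cV[R]_3 -> @triple R) (M2 M3 : R)
    (surfM : compact_surface M) (nuM : unit_normal_field M nu)
    (H1Q : H1_with_gradient M Q D)
    (M3_bounds : -1 < M3 < 2) (M2_bound : - (3 / 5) - 1 / 10 * M3 < M2) :
  {ae area M, forall x, M x ->
    is_f_e0 M2 M3 (D x) (nu x)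
      (1 / 2 * tnorm2 (D x)
       + M2 * (M3 + 2) / (2 * (M2 + M3 + 2)) * vnorm2 (tdiv (D x))
       + ((M3 ^+ 2 + 2 * M3 - 1) * M2 ^+ 2
          + (2 * M3 ^+ 2 + 5 * M3 + 4) * M2 * M3
          + (M3 ^+ 2 + 3 * M3 + 2) * M3 ^+ 2)
         / (2 * (M2 + M3 + 2) * (2 * M2 + 2 * M3 + 3))
         * (dot (nu x) (tdiv (D x))) ^+ 2
       + 1 / 2 * \sum_(i < 3)
           (M3 * mdot (D x i) (D x i)^T
            - 2 * M2 * M3 / (M2 + M3 + 2)
              * dot (nu x) (nu x i 0 *: (D x i *m tdiv (D x))))
       - M3 ^+ 2 / 8
         * mnorm2 (\sum_(i < 3) nu x i 0 *: (D x i + (D x i)^T))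
       + M3 ^+ 2 / 4 * ((M2 + M3) / (M2 + M3 + 2))
         * vnorm2 (\sum_(i < 3) nu x i 0 *: ((D x i)^T *m nu x)))}.
Proof.
have [_ _ _ Dtan _] := H1Q; have Dsym := H1_gradient_sym _ _ _ H1Q.
have aeF := ae_filter_ringOfSetsType (area M).
apply: (@filterS2 _ _ aeF _ _ _ _ Dtan Dsym) => x xtan xsym Mx.
have [n1 nuT] := nuM.2 x Mx.
(* The rows of D_j are tangent and [nu x] is orthogonal to the tangent plane. *)
have Dn j : D x j *m nu x = 0.
  apply/matrixP => i k; rewrite !ord1 [RHS]mxE -[RHS](nuT _ (xtan Mx j i)) mxE.
  by apply: eq_bigr => l _; rewrite !mxE mulrC.
(* M2 + M3 > -3/5 + (9/10) M3 > -3/5 - 9/10 = -3/2. *)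
have M23_gt0 : 0 < 2 * (M2 + M3) + 3 by lra.
rewrite -(f_e_optimal_normal_partE _ _ _ _ n1 Dn (xsym Mx) M23_gt0).
exact: optimal_normal_part_is_f_e0 n1 Dn (xsym Mx) M23_gt0.
Qed.
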